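(* Let $R$ be a commutative Noetherian ring with unity, $\lambda$ a length function on $R$-modules, $T$ a finitely generated commutative $R$-algebra and $\bar\gamma=(\gamma_1,\dots,\gamma_k)$ a tuple of generators of $T$. Let $0\to A\to B\to C\to0$ be an exact sequence of $T$-modules with $B$ locally $\lambda_R$-finite. Then for every $d\le k$, $h^{(d,\bar\gamma)}_\lambda(B)=h^{(d,\bar\gamma)}_\lambda(A)+h^{(d,\bar\gamma)}_\lambda(C)$.
   Context: A length function on $R$-modules is a function $\lambda$ from $R$-modules to $\mathbb{R}_{\ge0}\cup\{\infty\}$ with $\lambda(0)=0$, invariant under isomorphism, additive on short exact sequences, and with $\lambda(N)=\sup\{\lambda(N'):N'\le N$ finitely generated$\}$. Let $S=R[x_1,\dots,x_k]$; a $T$-module $M$ is viewed as an $S$-module $\langle M,\bar\gamma\rangle$ with $x_i$ acting as $\gamma_i$. A module is locally $\lambda_R$-finite if $\lambda(Rv)<\infty$ for all elements $v$; an $S$-module is $\lambda_S$-small if it is finitely generated over $S$ and locally $\lambda_R$-finite. For $\lambda_S$-small $M'$, choose a finitely generated $R$-submodule $V_0$ with $\lambda(V_0)<\infty$ and $SV_0=M'$; $\lambda(S_nV_0)$ ($S_n$ = polynomials of total degree $\le n$) equals a polynomial for large $n$ whose leading monomial $mt^e$ is $\mu(M')$ (independent of $V_0$; $\mu=0$ for the zero polynomial, of degree $-\infty$). Define $h^{(d)}_\lambda(M')=+\infty$ if $e>d$, $0$ if $e<d$, and $m/d!$ if $e=d$. For a $T$-module $M$, $h^{(d,\bar\gamma)}_\lambda(M)=\sup\{h^{(d)}_\lambda(\langle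 M',\bar\gamma\rangle): M'\le M$ a $\lambda_S$-small $S$-submodule$\}$. *)

(* Defs.v *)
From HB Require Import structures.
From mathcomp Require Import all_boot all_order all_algebra.
From mathcomp Require Import boolp classical_sets reals constructive_ereal ereal.
Set Implicit Arguments. Unset Strict Implicit. Unset Printing Implicit Defensive.
Import Order.TTheory GRing.Theory Num.Theory.
Local Open Scope ring_scope.
Local Open Scope classical_set_scope.

Section Span.
Variables (Rg : pzRingType) (M : lmodType Rg).

Definition span (G : set M) : set M :=
  [set x | exists s : seq (Rg * M),
      (forall p, p \in s -> G p.2) /\ x = \sum_(p <- s) p.1 *: p.2].

Definition span_pred (G : set M) : {pred M} := fun x => `[< span G x >].

Lemma span_closed (G : set M) : subsemimod_closed (span_pred G).
Proof.
split; [split|].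
- by apply/asboolP; exists [::]; split => //; rewrite big_nil.
- move=> x y /asboolP[s1 [H1 ->]] /asboolP[s2 [H2 ->]]; apply/asboolP.
  exists (s1 ++ s2); split; last by rewrite big_cat.
  by move=> p; rewrite mem_cat => /orP[/H1|/H2].
- move=> a x /asboolP[s [H ->]]; apply/asboolP.
  exists (map (fun p => (a * p.1, p.2)) s); split.
    by move=> p /mapP[q /H Hq ->].
  by rewrite big_map scaler_sumr; apply: eq_bigr => p _; rewrite scalerA.
Qed.

HB.instance Definition _ (G : set M) :=
  GRing.isSubmodClosed.Build Rg M (span_pred G) (span_closed G).

Definition subspan (G : set M) := {x : M | span_pred G x}.
HB.instance Definition _ (G : set M) := [isSub for (@sval M (span_pred G) : subspan G -> M)].
HB.instance Definition _ (G : set M) := [Choice of subspan G by <:].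
HB.instance Definition _ (G : set M) := [SubChoice_isSubLmodule of subspan G by <:].
End Span.


Local Open Scope ereal_scope.

Definition is_submodule (Rg : pzRingType) (M : lmodType Rg) (P : set M) : Prop :=
  [/\ P 0%R, (forall x y, P x -> P y -> P (x + y)%R)
    & (forall (r : Rg) x, P x -> P (r *: x)%R)].

Definition noetherian (Rg : comNzRingType) : Prop :=
  forall I : set Rg^o, is_submodule I ->
    exists n (gI : 'I_n -> Rg^o), I = span (range gI).

(* lam (subspan P) is the length of the R-submodule spanned by P;
   when P is itself a submodule N, this is lam(N) for N viewed as a module. *)
Definition lamS (Rg : pzRingType) (K : realType)
  (lam : forall M : lmodType Rg, \bar K) (M : lmodType Rg) (P : set M) : \bar K :=
  lam (subspan P).

Definition length_function (Rg : comNzRingType) (K : realType)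
  (lam : forall M : lmodType Rg, \bar K) : Prop :=
  [/\ (forall M : lmodType Rg, 0 <= lam M),
      (forall M : lmodType Rg, (forall x : M, x = 0%R) -> lam M = 0),
      (forall (M N : lmodType Rg) (f : {linear M -> N}), bijective f -> lam M = lam N),
      (forall (A B C : lmodType Rg) (f : {linear A -> B}) (g : {linear B -> C}),
          injective f -> (forall c, exists b, g b = c) ->
          (forall b, g b = 0%R <-> exists a, f a = b) ->
          lam B = lam A + lam C)
    & (forall M : lmodType Rg,
          lam M = ereal_sup [set x | exists n (v : 'I_n -> M),
                                     x = lamS lam (range v)])].

Section Algebra.
Variables (Rg : comNzRingType) (T : comAlgType Rg) (k : nat) (gam : 'I_k -> T).

Definition mono (alpha : 'I_k -> nat) : T := (\prod_(i < k) gam i ^+ alpha i)%R.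
Definition tdeg (alpha : 'I_k -> nat) : nat := (\sum_(i < k) alpha i)%N.

Definition generates : Prop :=
  forall t : T, exists s : seq (Rg * ('I_k -> nat)),
    t = (\sum_(p <- s) p.1 *: mono p.2)%R.

Definition Tmodule (M : lmodType Rg) (act : T -> M -> M) : Prop :=
  [/\ (forall t x y, act t (x + y)%R = (act t x + act t y)%R) /\
      (forall t (r : Rg) x, act t (r *: x)%R = (r *: act t x)%R),
      (forall t1 t2 x, act (t1 + t2)%R x = (act t1 x + act t2 x)%R),
      (forall t1 t2 x, act (t1 * t2)%R x = act t1 (act t2 x)),
      (forall x, act 1%R x = x)
    & (forall (r : Rg) t x, act (r *: t)%R x = (r *: act t x)%R)].

Definition Tlinear (M N : lmodType Rg) (actM : T -> M -> M) (actN : T -> N -> N)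
  (f : {linear M -> N}) : Prop :=
  forall t x, f (actM t x) = actN t (f x).

Section SModule.
Variables (M : lmodType Rg) (act : T -> M -> M).
(* S = R[x_1..x_k] acts on <M, gam> with x_i acting as gam_i *)

Definition Sn (V : set M) (n : nat) : set M :=
  span [set y | exists alpha x, (tdeg alpha <= n)%N /\ V x /\ y = act (mono alpha) x].

Definition Sspan (V : set M) : set M :=
  span [set y | exists alpha x, V x /\ y = act (mono alpha) x].

Definition S_submodule (P : set M) : Prop :=
  is_submodule P /\ (forall i x, P x -> P (act (gam i) x)).

Variables (K : realType) (lam : forall M : lmodType Rg, \bar K).

Definition loc_finite (P : set M) : Prop :=
  forall v, P v -> lamS lam [set v] < +oo.

Definition S_small (P : set M) : Prop :=
  [/\ S_submodule P, (exists n (gP : 'I_n -> M), P = Sspan (range gP)) & loc_finite P].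

Definition hval (d : nat) (p : {poly K}) : \bar K :=
  if p == 0%R then 0
  else if (d < (size p).-1)%N then +oo
  else if ((size p).-1 < d)%N then 0
  else (lead_coef p / (d`!)%:R)%:E.

(* h^(d)(<P, gam>) for a lam_S-small P: computed from any finitely generated
   R-submodule V0 with lam(V0) < oo and S V0 = P, and a polynomial p with
   lam(S_n V0) = p(n) for large n (independent of the choices, cf. paper). *)
Definition h_small (d : nat) (P : set M) : \bar K :=
  ereal_sup [set h | exists n (g0 : 'I_n -> M) (p : {poly K}) (N : nat),
     [/\ lamS lam (span (range g0)) < +oo,
         Sspan (span (range g0)) = P,
         (forall m, (N <= m)%N -> lamS lam (Sn (span (range g0)) m) = (p.[m%:R])%:E)
       & h = hval d p]].

Definition h_T (d : nat) : \bar K :=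
  ereal_sup [set h | exists P : set M, S_small P /\ h = h_small d P].

End SModule.
End Algebra.

(* Main.v *)
(* For an S-module generated by a finitely generated R-module V, the pieces S_n V of
   its filtration form a graded module over k + 1 variables, the extra variable being
   the identity; since R is noetherian and the modules are locally finite, all the
   pieces have finite length. Two facts about families of submodules of a fixed module,
   both proved by induction on the number of variables through the kernel and cokernel
   of the last variable y, give everything:
   - noetherianity: a stable subfamily L of a finitely generated family is finitely
     generated. If L : y is finitely generated then so is L, and the union of the
     L : y^j, being stable under colon by y, is finitely generated;
   - Hilbert-Serre: the length of the n-th piece is eventually a polynomial in n.
   Applied to S_n V `&` A, noetherianity is the Artin-Rees property: this family is a
   shift of some S_n W, which does not change the leading term. Leading terms of
   eventually nonnegative polynomials do not cancel, so the value attached to V is the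
   sum of those of W and of the image of V in C. The theorem follows by taking suprema,
   lifting generators from C to B. *)

Require Import Defs.
From HB Require Import structures.
From mathcomp Require Import all_boot all_order all_algebra.
From mathcomp Require Import boolp classical_sets reals constructive_ereal ereal.
From mathcomp Require polyrcf.
From mathcomp Require Import ring lra.
(* Again, since [vector] also exports a [span]. *)
Import Defs.
Import Order.TTheory GRing.Theory Num.Theory.
Set Implicit Arguments. Unset Strict Implicit. Unset Printing Implicit Defensive.
Local Open Scope ring_scope.
Local Open Scope classical_set_scope.

(** * Finitely generated submodules *)

Section Submodules.
Variable Rg : comNzRingType.
Implicit Types M N : lmodType Rg.

Lemma submod0 M (P : set M) : is_submodule P -> P 0.
Proof. by case. Qed.

Lemma submodD M (P : set M) x y : is_submodule P -> P x -> P y -> P (x + y).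
Proof. by case=> _ + _; apply. Qed.

Lemma submodZ M (P : set M) a x : is_submodule P -> P x -> P (a *: x).
Proof. by case=> _ _; apply. Qed.

Lemma submodN M (P : set M) x : is_submodule P -> P x -> P (- x).
Proof. by move=> sP; rewrite -scaleN1r; apply: submodZ. Qed.

Lemma submodB M (P : set M) x y : is_submodule P -> P x -> P y -> P (x - y).
Proof. by move=> sP Px Py; apply: submodD => //; apply: submodN. Qed.

Lemma span_submod M (G : set M) : is_submodule (span G).
Proof.
have [[h0 hD] hZ] := span_closed G.
split; first exact/asboolP.
- by move=> x y Gx Gy; apply/asboolP/hD; exact/asboolP.
- by move=> r x Gx; apply/asboolP/hZ; exact/asboolP.
Qed.

Lemma sub_span M (G : set M) : G `<=` span G.
Proof.
move=> x Gx; exists [:: (1, x)]; split; last by rewrite big_seq1 scale1r.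
by move=> p; rewrite inE => /eqP ->.
Qed.

Lemma span_min M (G P : set M) : is_submodule P -> G `<=` P -> span G `<=` P.
Proof.
move=> sP GP _ [s [Hs ->]]; elim: s Hs => [|p s IH] Hs.
  by rewrite big_nil; apply: submod0.
rewrite big_cons; apply: submodD => //.
  by apply: submodZ => //; apply/GP/Hs; rewrite inE eqxx.
by apply: IH => q qs; apply: Hs; rewrite inE qs orbT.
Qed.

Lemma span_id M (P : set M) : is_submodule P -> span P = P.
Proof. by move=> sP; apply/seteqP; split; [exact: span_min|exact: sub_span]. Qed.

Lemma spanS M (G H : set M) : G `<=` H -> span G `<=` span H.
Proof.
by move=> GH; apply: span_min; [exact: span_submod|exact: subset_trans (@sub_span _ _)].
Qed.

Lemma image_submod M N (f : {linear M -> N}) (P : set M) :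
  is_submodule P -> is_submodule (f @` P).
Proof.
move=> sP; split.
- by exists 0; [exact: submod0|rewrite linear0].
- by move=> _ _ [x Px <-] [y Py <-]; exists (x + y); [exact: submodD|rewrite linearD].
- by move=> r _ [x Px <-]; exists (r *: x); [exact: submodZ|rewrite linearZ].
Qed.

Lemma preimage_submod M N (f : {linear M -> N}) (P : set N) :
  is_submodule P -> is_submodule (f @^-1` P).
Proof.
move=> sP; split => /=.
- by rewrite linear0; exact: submod0.
- by move=> x y Px Py; rewrite linearD; exact: submodD.
- by move=> r x Px; rewrite linearZ; exact: submodZ.
Qed.

Lemma setI_submod M (P Q : set M) :
  is_submodule P -> is_submodule Q -> is_submodule (P `&` Q).
Proof.
move=> sP sQ; split => [|x y [Px Qx] [Py Qy]|r x [Px Qx]]; split;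
  by [exact: submod0|exact: submodD|exact: submodZ].
Qed.

Lemma zero_submod M : is_submodule [set 0 : M].
Proof. by split=> [|x y -> ->|r x ->] //=; rewrite ?addr0 ?scaler0. Qed.

Lemma image_span M N (f : {linear M -> N}) (G : set M) :
  f @` span G = span (f @` G).
Proof.
apply/seteqP; split.
  move=> _ [x Gx <-]; move: x Gx; apply: (@span_min _ _ (f @^-1` span (f @` G))).
    exact/preimage_submod/span_submod.
  by move=> x Gx; apply: sub_span; exists x.
apply: span_min; first exact/image_submod/span_submod.
by move=> _ [x Gx <-]; exists x => //; exact: sub_span.
Qed.

(** Generators form a sequence, so that arguments on their number are list inductions; the next
    lemmas translate from and to families indexed by ['I_n]. *)
Definition fgen M (P : set M) := exists s : seq M, P = span [set x | x \in s].

Lemma fgen_submod M (P : set M) : fgen P -> is_submodule P.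
Proof. by move=> [s ->]; exact: span_submod. Qed.

Lemma fgen_range M n (v : 'I_n -> M) : fgen (span (range v)).
Proof.
exists (codom v); congr span; apply/seteqP; split=> [_ [i _ <-]|x] /=.
  exact: codom_f.
by move/codomP=> [i ->]; exists i.
Qed.

Lemma fgen_rangeP M (P : set M) : fgen P -> exists n (v : 'I_n -> M), P = span (range v).
Proof.
move=> [s ->]; exists (size s), (tnth (in_tuple s)); congr span.
apply/seteqP; split=> [x|_ [i _ <-]] /=; last exact: mem_tnth.
by move/(@tnthP _ _ (in_tuple s)) => [i ->]; exists i.
Qed.

Lemma fgen_image M N (f : {linear M -> N}) (P : set M) : fgen P -> fgen (f @` P).
Proof.
move=> [s ->]; exists [seq f x | x <- s]; rewrite image_span; congr span.
by apply/seteqP; split=> [_ [x xs <-]|_ /mapP[x xs ->]] /=; [exact: map_f|exists x].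
Qed.

(* [y X + Q] and, below, the part of [X] mapped by [y] into [Q]: the cokernel
   and kernel of multiplication by [y] between subquotients. *)
Definition addim M N (y : {linear M -> N}) (X : set M) (Q : set N) : set N :=
  [set z | exists2 x, X x & Q (z - y x)].

Definition colon M N (y : {linear M -> N}) (X : set M) (Q : set N) : set M :=
  [set x | X x /\ Q (y x)].

Lemma addim_submod M N (y : {linear M -> N}) X Q :
  is_submodule X -> is_submodule Q -> is_submodule (addim y X Q).
Proof.
move=> sX sQ; split.
- by exists 0; [exact: submod0|rewrite linear0 subr0; exact: submod0].
- move=> z z' [x Xx Qx] [x' Xx' Qx']; exists (x + x'); first exact: submodD.
  by rewrite linearD opprD addrACA; exact: submodD.
- move=> r z [x Xx Qx]; exists (r *: x); first exact: submodZ.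
  by rewrite linearZ -scalerBr; exact: submodZ.
Qed.

Lemma addim_r M N (y : {linear M -> N}) X Q :
  is_submodule X -> Q `<=` addim y X Q.
Proof. by move=> sX z Qz; exists 0; [exact: submod0|rewrite linear0 subr0]. Qed.

Lemma addim_l M N (y : {linear M -> N}) X Q x :
  is_submodule Q -> X x -> addim y X Q (y x).
Proof. by move=> sQ Xx; exists x => //; rewrite subrr; exact: submod0. Qed.

Lemma addim_min M N (y : {linear M -> N}) X Q (P : set N) :
  is_submodule P -> Q `<=` P -> (forall x, X x -> P (y x)) -> addim y X Q `<=` P.
Proof.
by move=> sP QP XP z [x Xx Qx]; rewrite -(subrK (y x) z); apply: submodD; auto.
Qed.

Lemma colon_submod M N (y : {linear M -> N}) X Q :
  is_submodule X -> is_submodule Q -> is_submodule (colon y X Q).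
Proof. by move=> sX sQ; apply: setI_submod => //; exact: preimage_submod. Qed.

Lemma fgen_addim M N (y : {linear M -> N}) X Q : fgen X -> fgen Q -> fgen (addim y X Q).
Proof.
move=> [s ->] [t ->]; exists ([seq y x | x <- s] ++ t); apply/seteqP; split.
  apply: addim_min; first exact: span_submod.
    by apply: spanS => x /= xt; rewrite mem_cat xt orbT.
  move=> x sx; apply: (@spanS _ (y @` [set x | x \in s])).
    by move=> _ [z /= zs <-]; rewrite mem_cat map_f.
  by rewrite -image_span; exists x.
apply: span_min; first by apply: addim_submod; exact: span_submod.
move=> z /=; rewrite mem_cat => /orP[/mapP[x xs ->]|zt].
  by apply: addim_l; [exact: span_submod|exact: sub_span].
by apply: addim_r; [exact: span_submod|exact: sub_span].
Qed.

Lemma fgen0 M : fgen [set 0 : M].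
Proof.
exists [::]; apply/seteqP; split; first by move=> _ ->; exact: submod0 (@span_submod _ _).
by apply: span_min; [exact: zero_submod|].
Qed.

Lemma span_cons M (a : M) s x : span [set z | z \in a :: s] x ->
  exists r p, span [set z | z \in s] p /\ x = r *: a + p.
Proof.
pose D := [set x : M | exists r p, span [set z | z \in s] p /\ x = r *: a + p].
have sS := @span_submod M [set z | z \in s].
apply: (@span_min _ _ D) => [|{}x /=].
  split.
  - by exists 0, 0; split; [exact: submod0|rewrite scale0r addr0].
  - move=> _ _ [r [p [sp ->]]] [r' [p' [sp' ->]]]; exists (r + r'), (p + p').
    by split; [exact: submodD|rewrite scalerDl addrACA].
  - move=> c _ [r [p [sp ->]]]; exists (c * r), (c *: p).
    by split; [exact: submodZ|rewrite scalerDr scalerA].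
rewrite inE => /orP[/eqP ->|xs]; first by exists 1, 0; split; [exact: submod0|rewrite scale1r addr0].
by exists 0, x; split; [exact: sub_span|rewrite scale0r add0r].
Qed.

(** Induction on the generators of [P]: the coefficients of the first one form an ideal, finitely
    generated because [Rg] is noetherian, and the part of [Q] without that coefficient is covered by
    induction. *)
Lemma fgen_sub M (P Q : set M) : noetherian Rg ->
  fgen P -> is_submodule Q -> Q `<=` P -> fgen Q.
Proof.
move=> noeR [s ->]; elim: s Q => [|a s IH] Q sQ QP.
  suff -> : Q = [set 0] by exact: fgen0.
  apply/seteqP; split=> [x /QP|_ ->]; last exact: submod0.
  by apply: span_min => //; exact: zero_submod.
have sS := @span_submod M [set z | z \in s].
(* The ideal of coefficients of [a] in elements of [Q]; below, [w i] is an element of [Q] with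
   coefficient [gI i]. *)
pose I : set Rg^o := [set r | exists2 p, span [set z | z \in s] p & Q (r *: a + p)].
have sI : is_submodule I.
  split.
  - by exists 0; [exact: submod0|rewrite scale0r addr0; exact: submod0].
  - move=> r r' [p sp Qp] [p' sp' Qp']; exists (p + p'); first exact: submodD.
    by rewrite scalerDl addrACA; exact: submodD.
  - move=> c r [p sp Qp]; exists (c *: p); first exact: submodZ.
    by rewrite -scalerA -scalerDr; exact: submodZ.
have [n [gI IE]] := noeR I sI.
have /choice[w wP] : forall i, exists q : M, Q q /\
    exists2 p, span [set z | z \in s] p & q = gI i *: a + p.
  move=> i; have [p sp Qp] : I (gI i) by rewrite IE; apply: sub_span; exists i.
  by exists (gI i *: a + p); split=> //; exists p.
have [t tE] : fgen (Q `&` span [set z | z \in s]).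
  by apply: IH; [exact: setI_submod|by move=> x []].
exists (codom w ++ t); apply/seteqP; split; last first.
  apply: span_min => // x /=; rewrite mem_cat => /orP[/codomP[i ->]|xt].
    by have [] := wP i.
  by have [] : (Q `&` span [set z | z \in s]) x by rewrite tE; exact: sub_span.
have sW := @span_submod M [set x | x \in codom w ++ t].
move=> q Qq; have [r [p [sp qE]]] := span_cons (QP _ Qq).
have Ir : I r by exists p => //; rewrite -qE.
(* Coefficients of [a] realized in [Q] by the proposed generators. All [gI i] lie in [J], hence so
   does [r], and subtracting the corresponding element from [q] leaves a member of [span s]. *)
pose J : set Rg^o := [set r | exists2 p, span [set z | z \in s] p &
  (Q `&` span [set x | x \in codom w ++ t]) (r *: a + p)].
have sQW := setI_submod sQ sW.
have [p' sp' [Qz Wz]] : J r.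
  move: Ir; rewrite IE; apply: span_min.
    split.
    - by exists 0; [exact: submod0|rewrite scale0r addr0; exact: submod0].
    - move=> b b' [p1 sp1 Qp1] [p2 sp2 Qp2]; exists (p1 + p2); first exact: submodD.
      by rewrite scalerDl addrACA; exact: submodD.
    - move=> c b [p1 sp1 Qp1]; exists (c *: p1); first exact: submodZ.
      by rewrite -scalerA -scalerDr; exact: submodZ.
  move=> _ [i _ <-]; have [Qw [p1 sp1 wE]] := wP i; exists p1 => //.
  by rewrite -wE; split=> //; apply: sub_span; rewrite /= mem_cat codom_f.
rewrite -(subrK (r *: a + p') q); apply: submodD => //.
have : (Q `&` span [set z | z \in s]) (q - (r *: a + p')).
  split; first exact: submodB.
  by rewrite qE opprD addrACA subrr add0r; exact: submodB.
by rewrite tE; apply: spanS => x /= xt; rewrite mem_cat xt orbT.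
Qed.

End Submodules.

(** * Length of submodules *)

Section Restriction.
Variables (Rg : comNzRingType) (M N : lmodType Rg) (y : {linear M -> N}).
Variables (P : set M) (Q : set N) (yPQ : forall x, span P x -> span Q (y x)).

Lemma span_pred_restr x : span_pred P x -> span_pred Q (y x).
Proof. by move=> /asboolP Px; apply/asboolP/yPQ. Qed.

(** A length function evaluates module types, not subsets, so a map between submodules is turned
    into a linear map between the types [subspan P] and [subspan Q]. *)
Definition restr (x : subspan P) : subspan Q :=
  exist _ (y (sval x)) (span_pred_restr (svalP x)).

Lemma restr_linear : linear restr.
Proof. by move=> a u v; apply: val_inj; rewrite /= linearP. Qed.

HB.instance Definition _ := GRing.isLinear.Build Rg (subspan P) (subspan Q) _ restr restr_linear.

End Restriction.

Section Length.
Variables (Rg : comNzRingType) (K : realType) (lam : forall M : lmodType Rg, \bar K).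
Hypothesis lamP : length_function lam.
Implicit Types M N : lmodType Rg.
Local Open Scope ereal_scope.

Lemma lamS_ge0 M (P : set M) : 0 <= lamS lam P.
Proof. by case: lamP => + _ _ _ _; apply. Qed.

(** The types [subspan (span P)] and [subspan P] are only isomorphic, through the two restrictions
    of the identity. *)
Lemma lamS_span M (P : set M) : lamS lam (span P) = lamS lam P.
Proof.
have sP := @span_submod _ M P.
have h1 x : span P x -> span (span P) x by rewrite (span_id sP).
have h2 x : span (span P) x -> span P x by rewrite (span_id sP).
case: lamP => _ _ iso _ _; symmetry.
apply: (iso _ _ (restr (y := idfun) h1)).
by exists (restr (y := idfun) h2) => x; apply: val_inj.
Qed.

(** Additivity of [lam] on the kernel, source and image of [y] restricted to [P]. *)
Lemma lamS_ker_image M N (y : {linear M -> N}) (P : set M) : is_submodule P ->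
  lamS lam P = lamS lam (colon y P [set 0%R]) + lamS lam (y @` P).
Proof.
move=> sP; case: lamP => _ _ _ add _.
have sK := colon_submod y sP (@zero_submod _ N).
have h1 x : span (colon y P [set 0%R]) x -> span P (idfun x).
  by rewrite (span_id sK) (span_id sP); case.
have h2 x : span P x -> span (y @` P) (y x).
  by rewrite -image_span; exists x.
apply: (add _ _ _ (restr h1) (restr h2)).
- by move=> u v /(congr1 val) /= /val_inj.
- move=> [c /= cP]; have := cP; move=> /asboolP; rewrite -image_span => -[x Px yx].
  by exists (exist _ x (asboolT Px)); apply: val_inj.
- move=> [b bP]; split.
    move=> /(congr1 val) /= yb; have /asboolP := bP; rewrite (span_id sP) => Pb.
    have kb : span_pred (colon y P [set 0%R]) b by apply/asboolP; rewrite (span_id sK).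
    by exists (exist _ b kb); apply: val_inj.
  move=> [[a aP] /(congr1 val) /= ab]; apply: val_inj => /=; rewrite -ab.
  by have /asboolP := aP; rewrite (span_id sK) => -[].
Qed.

Lemma lamS0 M : lamS lam [set 0%R : M] = 0.
Proof.
case: lamP => _ h _ _ _; apply: h => -[x xP]; apply: val_inj => /=.
by have /asboolP := xP; rewrite (span_id (zero_submod M)).
Qed.

Lemma lamS_inj_image M N (y : {linear M -> N}) (P : set M) :
  is_submodule P -> injective y -> lamS lam (y @` P) = lamS lam P.
Proof.
move=> sP yI; rewrite (lamS_ker_image y sP).
suff -> : colon y P [set 0%R] = [set 0%R] by rewrite lamS0 add0e.
apply/seteqP; split=> [x [_ /= yx]|_ ->] /=; first by apply: yI; rewrite linear0.
by split; [exact: submod0|rewrite /= linear0].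
Qed.

(** By the supremum axiom: each finitely generated submodule of [subspan P] is isomorphic to one of
    [subspan Q], so the first supremum is over a smaller set of values. *)
Lemma lamS_le M (P Q : set M) : P `<=` Q -> lamS lam P <= lamS lam Q.
Proof.
move=> PQ; case: lamP => _ _ _ _ sup; rewrite {1 2}/lamS !sup.
apply: ge_ereal_sup => _ [n [v ->]]; apply: ereal_sup_ubound.
have hPQ x : span P x -> span Q (idfun x) by exact: spanS.
exists n, (fun i => restr hPQ (v i)).
rewrite -lamS_span -(@lamS_inj_image _ _ (restr hPQ)); last first.
- by move=> u w /(congr1 val) /= /val_inj.
- exact: span_submod.
by rewrite image_span lamS_span image_comp.
Qed.

Lemma lamS_prod M N (P : set M) (Q : set N) : is_submodule P -> is_submodule Q ->
  lamS lam (P `*` Q) = lamS lam P + lamS lam Q.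
Proof.
move=> sP sQ.
have sPQ : is_submodule (P `*` Q).
  split=> [|x z [Px Qx] [Pz Qz]|r x [Px Qx]]; split;
  by [exact: submod0|exact: submodD|exact: submodZ].
pose j (q : N) : M * N := (0%R, q).
have jl : linear j by move=> a u v; rewrite /j; congr pair; rewrite /= scaler0 addr0.
pose jL := HB.pack_for {linear N -> (M * N)%type} j (GRing.isLinear.Build _ _ _ _ j jl).
pose p1 (q : M * N) : M := q.1.
have p1l : linear p1 by [].
pose pL := HB.pack_for {linear (M * N)%type -> M} p1 (GRing.isLinear.Build _ _ _ _ p1 p1l).
rewrite (lamS_ker_image pL sPQ) addeC; congr (_ + _).
  congr lamS; apply/seteqP; split=> [_ [[a b] [Pa _] <-]|a Pa] //.
  by exists (a, 0%R) => //; split=> //; exact: submod0.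
rewrite -(@lamS_inj_image _ _ jL Q) //; last by move=> u v [].
congr lamS; apply/seteqP; split=> [[a b] [[/= Pa Qb] /= a0]|_ [b Qb <-]].
  by exists b => //; rewrite /j -a0.
by split=> //; split=> //; exact: submod0.
Qed.

(** The map sending [(x, q)] to [y x + q] on [X * Q] has image [addim y X Q], and its kernel, made
    of the pairs [(x, - y x)], is a copy of [colon y X Q]. Sums rather than differences keep
    infinite lengths legitimate. *)
Lemma lamS_addim M N (y : {linear M -> N}) (X : set M) (Q : set N) :
  is_submodule X -> is_submodule Q ->
  lamS lam X + lamS lam Q = lamS lam (colon y X Q) + lamS lam (addim y X Q).
Proof.
move=> sX sQ.
pose a (q : M * N) : N := (y q.1 + q.2)%R.
have al : linear a.
  move=> c u v; rewrite /a /= linearP.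
  by rewrite scalerDr addrACA.
pose aL := HB.pack_for {linear (M * N)%type -> N} a (GRing.isLinear.Build _ _ _ _ a al).
pose b (x : M) : M * N := (x, - y x)%R.
have bl : linear b by move=> c u v; rewrite /b; congr pair; rewrite /= linearP opprD scalerN.
pose bL := HB.pack_for {linear M -> (M * N)%type} b (GRing.isLinear.Build _ _ _ _ b bl).
have sXQ : is_submodule (X `*` Q).
  split=> [|x z [Px Qx] [Pz Qz]|r x [Px Qx]]; split;
  by [exact: submod0|exact: submodD|exact: submodZ].
rewrite -lamS_prod // (lamS_ker_image aL sXQ); congr (_ + _); last first.
  congr lamS; apply/seteqP; split=> [_ [[x q] [/= Xx Qq] <-]|z [x Xx Qz]].
    by exists x => //; rewrite /= /a /= [(y x + q)%R]addrC addrK.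
  by exists (x, z - y x)%R => //; rewrite /= /a /= addrC subrK.
rewrite -(@lamS_inj_image _ _ bL); last by move=> u v [].
  congr lamS; apply/seteqP; split=> [[x q] [[/= Xx Qq] /= e]|_ [x [Xx Qx] <-]].
    have qE : q = (- y x)%R by apply/eqP; rewrite -addr_eq0 addrC -[(_ + _)%R]/(a (x, q)) e.
    by exists x; rewrite /= /b ?qE //; split=> //; rewrite -[y x]opprK -qE; exact: submodN.
  by split; [split=> //=; exact: submodN|rewrite /= /a /= subrr].
exact: colon_submod.
Qed.

(** Each new generator [x] adds at most the length of the cyclic module it spans, which is finite by
    local finiteness. *)
Lemma lamS_fgen M (P : set M) : loc_finite lam [set: M] -> fgen P -> lamS lam P < +oo.
Proof.
move=> lf [s ->]; elim: s => [|x s IH].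
  rewrite lamS_span (le_lt_trans (y := lamS lam [set 0%R : M])) //.
    exact: lamS_le.
  by rewrite lamS0.
have sub : [set z | z \in x :: s] `<=` addim idfun (span [set x]) (span [set z | z \in s]).
  move=> z /=; rewrite inE => /orP[/eqP ->|zs].
    by apply: (@addim_l _ _ _ idfun); [exact: span_submod|exact: sub_span].
  by apply: addim_r; [exact: span_submod|exact: sub_span].
rewrite lamS_span; apply: le_lt_trans (lamS_le sub) _.
apply: le_lt_trans (_ : lamS lam (span [set x]) + lamS lam (span [set z | z \in s]) < _).
  by rewrite (lamS_addim idfun); [exact: leeDr (lamS_ge0 _)|exact: span_submod..].
by rewrite lte_add_pinfty // lamS_span; exact: lf.
Qed.

(** A real value, so that lengths can be subtracted; [fine] returns 0 on an infinite length, a case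
    that [lenK] excludes. *)
Definition len M (P : set M) : K := fine (lamS lam P).

Lemma lenK M (P : set M) : loc_finite lam [set: M] -> fgen P -> (len P)%:E = lamS lam P.
Proof. by move=> lf fP; rewrite fineK // ge0_fin_numE ?lamS_ge0 //; exact: lamS_fgen. Qed.

Lemma len_addim M (y : {linear M -> M}) (X Q : set M) :
  noetherian Rg -> loc_finite lam [set: M] -> fgen X -> fgen Q ->
  (len X + len Q = len (colon y X Q) + len (addim y X Q))%R.
Proof.
move=> noeR lf fX fQ; have sX := fgen_submod fX; have sQ := fgen_submod fQ.
apply: EFin_inj; rewrite !EFinD !lenK //; first exact: lamS_addim.
  exact: fgen_addim.
by apply: fgen_sub fX _ _; [|exact: colon_submod|move=> x []].
Qed.

End Length.

(** * Graded families and Hilbert-Serre *)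

Section Graded.
Variables (Rg : comNzRingType) (M : lmodType Rg) (y : nat -> {linear M -> M}).
Hypothesis noeR : noetherian Rg.
Hypothesis yC : forall i j x, y i (y j x) = y j (y i x).
Implicit Types (X : set M) (P Q L : nat -> set M).

(** This is [Q + y_0 X + ... + y_{k-1} X]. The last variable is absorbed into [Q] first, which is
    the form needed by inductions on [k]. *)
Fixpoint gsum k X (Q : set M) : set M :=
  if k is k'.+1 then gsum k' X (addim (y k') X Q) else Q.

Lemma gsum_submod k X (Q : set M) :
  is_submodule X -> is_submodule Q -> is_submodule (gsum k X Q).
Proof.
move=> sX; elim: k Q => [|k IH] Q sQ //=.
by apply: IH; exact: addim_submod.
Qed.

Lemma gsum_min k X (Q R : set M) : is_submodule R -> Q `<=` R ->
  (forall i x, (i < k)%N -> X x -> R (y i x)) -> gsum k X Q `<=` R.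
Proof.
move=> sR; elim: k Q => [|k IH] Q //= QR XR.
apply: IH; last by move=> i x ik; apply: XR; exact: ltnW.
by apply: addim_min => // x; exact: XR.
Qed.

Lemma gsum_r k X (Q : set M) : is_submodule X -> Q `<=` gsum k X Q.
Proof.
move=> sX; elim: k Q => [|k IH] Q //=.
by apply: subset_trans (IH _); exact: addim_r.
Qed.

Lemma gsum_l k X (Q : set M) i x : is_submodule X -> is_submodule Q ->
  (i < k)%N -> X x -> gsum k X Q (y i x).
Proof.
move=> sX; elim: k Q => [|k IH] Q //= sQ.
rewrite ltnS leq_eqVlt => /orP[/eqP ->|ik] Xx.
  by apply: gsum_r => //; exact: addim_l.
by apply: IH => //; exact: addim_submod.
Qed.

Lemma gsumS k X X' (Q Q' : set M) : is_submodule X' -> is_submodule Q' ->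
  X `<=` X' -> Q `<=` Q' -> gsum k X Q `<=` gsum k X' Q'.
Proof.
move=> sX' sQ' XX' QQ'; apply: gsum_min; first exact: gsum_submod.
  by apply: subset_trans QQ' _; exact: gsum_r.
by move=> i x ik /XX'; exact: gsum_l.
Qed.

Lemma fgen_gsum k X (Q : set M) : fgen X -> fgen Q -> fgen (gsum k X Q).
Proof. by move=> fX; elim: k Q => [|k IH] Q fQ //=; apply: IH; exact: fgen_addim. Qed.

Definition stable k P := forall i n x, (i < k)%N -> P n x -> P n.+1 (y i x).

(* The graded module [P / Q] over [R[y_0, .., y_{k-1}]] is generated in bounded degrees. *)
Definition generated k P Q :=
  exists c, forall n, (c <= n)%N -> P n.+1 `<=` gsum k (P n) (Q n.+1).

(** These are the graded submodules of [P / Q], given by their preimages in [P]: quotients are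
    always handled as pairs of submodules of [M]. *)
Definition subfamily k P Q L :=
  [/\ forall n, is_submodule (L n), forall n, Q n `<=` L n,
      forall n, L n `<=` P n & stable k L].

(** [P / coker] is the cokernel of [y k] on [P / Q]. In degree 0 no element comes from below. *)
Definition coker k P Q n : set M :=
  if n is m.+1 then addim (y k) (P m) (Q m.+1) else Q 0%N.

(** The graded colon [L : y k] inside [P]. For [L = Q], its quotient by [Q] is the kernel of [y k]
    on [P / Q]. *)
Definition colonf k P L n := colon (y k) (P n) (L n.+1).

(** * Noetherianity: from [k] to [k.+1] variables *)

Section Step.
Variables (k : nat) (P Q : nat -> set M).
Hypothesis fP : forall n, fgen (P n).
Hypothesis stP : stable k.+1 P.
Hypothesis QP : subfamily k.+1 P Q Q.

Let sP n : is_submodule (P n). Proof. exact: fgen_submod. Qed.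
Let sQ n : is_submodule (Q n). Proof. by case: QP. Qed.
Let sub_QP n : Q n `<=` P n. Proof. by case: QP. Qed.
Let stQ : stable k.+1 Q. Proof. by case: QP. Qed.

Lemma coker_submod n : is_submodule (coker k P Q n).
Proof. by case: n => [|n] //=; exact: addim_submod. Qed.

Lemma coker_sub n : coker k P Q n `<=` P n.
Proof. by case: n => [|n] //=; apply: addim_min => // x; exact: stP. Qed.

Lemma coker_stable : stable k (coker k P Q).
Proof.
move=> i [|n] x ik /=.
  by move=> Qx; apply: addim_r => //; apply: stQ => //; exact: ltnW.
move: x; apply: (@addim_min _ _ _ _ _ _ (y i @^-1` addim (y k) (P n.+1) (Q n.+2))).
- exact/preimage_submod/addim_submod.
- by move=> x Qx; apply: addim_r => //; apply: stQ => //; exact: ltnW.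
- by move=> x Px /=; rewrite yC; apply: addim_l => //; apply: stP => //; exact: ltnW.
Qed.

Lemma coker_subfamily : subfamily k P (coker k P Q) (coker k P Q).
Proof.
by split=> [n|n|n|]; [exact: coker_submod| |exact: coker_sub|exact: coker_stable].
Qed.

(** True by computation: [gsum k.+1] first replaces [Q n.+1] by [addim (y k) (P n) (Q n.+1)], which
    is the cokernel family in degree [n.+1]. *)
Lemma coker_generated : generated k.+1 P Q -> generated k P (coker k P Q).
Proof. by []. Qed.

Lemma colonf_subfamily L : subfamily k.+1 P Q L -> subfamily k.+1 P Q (colonf k P L).
Proof.
move=> [sL QL LP stL]; split=> [n|n x Qx|n x []|i n x ik [Px Lx]] //.
- exact: colon_submod.
- by split; [exact: sub_QP|apply/QL/stQ].
- by split; [exact: stP|rewrite yC; exact: stL].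
Qed.

Hypothesis noeth_coker : forall L, subfamily k P (coker k P Q) L ->
  generated k L (coker k P Q).

(** The image of [L] in the cokernel of [y k] is generated in bounded degrees by [noeth_coker].
    Lifting back, an element of [L n.+1] is a combination of the first [k] variables on [L n],
    modulo [Q], plus some [y k p]; this last term is then in [L], which puts [p] in the colon. *)
Lemma generated_mod_colon L : subfamily k.+1 P Q L -> exists c, forall n, (c <= n)%N ->
  L n.+1 `<=` addim (y k) (colonf k P L n) (gsum k (L n) (Q n.+1)).
Proof.
move=> [sL QL LP stL].
(* The sum of [L] and the cokernel family, that is, the image of [L] in the cokernel. *)
pose L' n := addim idfun (coker k P Q n) (L n).
have sC := coker_submod.
have sL' n : is_submodule (L' n) by exact: addim_submod.
have [|c cP] := noeth_coker (L := L').
  split=> // [n x Cx|n|i n].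
  - exact: (@addim_l _ _ _ idfun).
  - by apply: addim_min => //; exact: coker_sub.
  - move=> x ik; move: x.
    apply: (@addim_min _ _ _ _ _ _ (y i @^-1` L' n.+1)); first exact: preimage_submod.
      by move=> x Lx; apply: addim_r => //; apply: stL => //; exact: ltnW.
    by move=> x Cx; apply: (@addim_l _ _ _ idfun) => //; exact: coker_stable.
exists c => n cn z Lz.
have L'z : L' n.+1 z by exact: addim_r.
(* The cokernel part of [L' n] is sent by the first [k] variables into the cokernel family in degree
   [n.+1], so [L n] can replace [L' n]. *)
have : gsum k (L n) (coker k P Q n.+1) z.
  move: (cP n cn z L'z); apply: gsum_min; first exact: gsum_submod.
    exact: gsum_r.
  move=> i x ik; move: x.
  apply: (@addim_min _ _ _ _ _ _ (y i @^-1` gsum k (L n) (coker k P Q n.+1))).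
  - exact/preimage_submod/gsum_submod.
  - by move=> x Lx; exact: gsum_l.
  - by move=> x Cx; apply: gsum_r => //; exact: coker_stable.
have sub : gsum k (L n) (coker k P Q n.+1) `<=`
    addim (y k) (P n) (gsum k (L n) (Q n.+1)).
  have sG : is_submodule (gsum k (L n) (Q n.+1)) by exact: gsum_submod.
  apply: gsum_min; first exact: addim_submod.
    apply: addim_min; first exact: addim_submod.
      by move=> x Qx; apply: addim_r => //; exact: gsum_r.
    by move=> x Px; exact: addim_l.
  by move=> i x ik Lx; apply: addim_r => //; exact: gsum_l.
move=> /sub[p Pp Gp]; exists p => //; split=> //.
rewrite -[y k p](subKr z); apply: submodB => //.
by move: Gp; apply: gsum_min => // i x ik; apply: stL; exact: ltnW.
Qed.

(** In [generated_mod_colon] the colon is expanded by its own generation, and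
    [y k (y i x) = y i (y k x)] with [y k x] in [L]. *)
Lemma generated_colon L : subfamily k.+1 P Q L ->
  generated k.+1 (colonf k P L) Q -> generated k.+1 L Q.
Proof.
move=> LP [c cP]; have [c' c'P] := generated_mod_colon LP.
have [sL QL _ stL] := LP; have [sC _ _ _] := colonf_subfamily LP.
(* The bound is [c.+1] because the colon occurs one degree below the element of [L]. *)
exists (maxn c.+1 c') => -[|n]; rewrite geq_max => /andP[] // cn c'n.
apply: subset_trans (c'P _ c'n) _.
have sG : is_submodule (gsum k.+1 (L n.+1) (Q n.+2)) by exact: gsum_submod.
apply: addim_min => //.
  apply: gsum_min => //; first exact: gsum_r.
  by move=> i x ik Lx; apply: gsum_l => //; exact: ltnW.
move=> x /(cP n cn); move: x.
apply: (@gsum_min _ _ _ (y k @^-1` gsum k.+1 (L n.+1) (Q n.+2))).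
- exact: preimage_submod.
- by move=> x Qx; apply: gsum_r => //; exact: stQ.
- by move=> i x ik [_ Lx]; rewrite /preimage /mkset yC; exact: gsum_l.
Qed.

(* The colons [L : y^j] increase to a family [U] with [U : y = U], which is generated
   by [generated_mod_colon]; by noetherianity of [P c] it is reached at a finite [j]. *)
Lemma generated_step L : subfamily k.+1 P Q L -> generated k.+1 L Q.
Proof.
move=> LP.
pose F j := iter j (colonf k P) L.
have FP j : subfamily k.+1 P Q (F j).
  by elim: j => [|j IH] //=; exact: colonf_subfamily.
suff [J gJ] : exists J, generated k.+1 (F J) Q.
  by elim: J gJ => [|J IH] // gJ; apply: IH; apply: generated_colon.
have sF j n : is_submodule (F j n) by case: (FP j).
have FS j n : F j n `<=` F j.+1 n.
  by have [_ _ FPj stF] := FP j; move=> x Fx; split; [exact: FPj|exact: stF].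
have FD j i n : F j n `<=` F (j + i)%N n.
  elim: i => [|i IH]; first by rewrite addn0.
  by rewrite addnS; apply: subset_trans IH (FS _ _).
have Fle j j' n : (j <= j')%N -> F j n `<=` F j' n.
  by move=> jj'; rewrite -(subnKC jj'); exact: FD.
pose U n := [set x | exists j, F j n x].
have UP : subfamily k.+1 P Q U.
  split=> [n|n x Qx|n x [j]|i n x ik [j Fx]].
  - split=> [|x z [j Fx] [j' Fz]|r x [j Fx]]; first by exists 0%N; exact: submod0.
      exists (maxn j j'); apply: submodD => //.
        by move: Fx; apply: Fle; exact: leq_maxl.
      by move: Fz; apply: Fle; exact: leq_maxr.
    by exists j; exact: submodZ.
  - by exists 0%N; case: LP => _ + _ _; exact.
  - by case: (FP j) => _ _ + _; exact.
  - by exists j; case: (FP j) => _ _ _; apply.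
have [c cP] := generated_mod_colon UP.
have [sU QU sub_UP stU] := UP.
have gU n : (c <= n)%N -> U n.+1 `<=` gsum k.+1 (U n) (Q n.+1).
  move=> cn; apply: subset_trans (cP _ cn) _.
  have sG : is_submodule (gsum k.+1 (U n) (Q n.+1)) by exact: gsum_submod.
  apply: addim_min => //.
    apply: gsum_min => //; first exact: gsum_r.
    by move=> i x ik Lx; apply: gsum_l => //; exact: ltnW.
  (* Here [U] absorbs its own colon: if [y k x] is in [F j], then [x] is in [F j.+1]. *)
  by move=> x [Px [j Fx]]; apply: gsum_l => //; exists j.+1.
have [s sE] : fgen (U c) by apply: fgen_sub (fP c) _ _.
have [J JP] : exists J, forall x, x \in s -> F J c x.
  have : forall x, x \in s -> U c x by rewrite sE => x xs; exact: sub_span.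
  elim: s {sE} => [|x s IH] Us; first by exists 0%N.
  have [J JP] : exists J, forall x, x \in s -> F J c x.
    by apply: IH => z zs; apply: Us; rewrite inE zs orbT.
  have [j Fx] : U c x by apply: Us; rewrite inE eqxx.
  exists (maxn J j) => z; rewrite inE => /orP[/eqP ->|/JP].
    by move: Fx; apply: Fle; exact: leq_maxr.
  by apply: Fle; exact: leq_maxl.
have [_ QF _ stF] := FP J.
(* From degree [c] on, [U] is generated by [U c], which is inside the stable family [F J]. Hence
   both agree there and [F J] inherits the generation of [U]. *)
have UF n : (c <= n)%N -> U n `<=` F J n.
  move=> cn; rewrite -(subnKC cn); elim: (n - c)%N => [|m IH].
    by rewrite addn0 sE; exact: span_min.
  rewrite addnS; apply: subset_trans (gU _ _) _; first exact: leq_addr.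
  by apply: gsum_min => // i x ik /IH; exact: stF.
exists J, c => n cn x Fx.
have Ux : U n.+1 x by exists J.
by move: (gU n cn x Ux); apply: gsumS => //; exact: UF.
Qed.

End Step.

Lemma stableW k P : stable k.+1 P -> stable k P.
Proof. by move=> st i n x ik; apply: st; exact: ltnW. Qed.

(** Induction on [k]: the cokernel of the last variable is generated over the others, so the
    induction hypothesis provides [noeth_coker]. Without variables, [P] is inside [Q] in large
    degrees, and so is [L]. *)
Theorem graded_noetherian k P Q L : (forall n, fgen (P n)) -> stable k P ->
  subfamily k P Q Q -> generated k P Q -> subfamily k P Q L -> generated k L Q.
Proof.
move=> fP; elim: k Q L => [|k IH] Q L stP QP gP LP.
  case: gP => c cP; exists c => n cn; apply: subset_trans (cP n cn).
  by case: LP.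
apply: generated_step LP => // L' L'P.
apply: IH L'P; [exact: stableW|exact: coker_subfamily|exact: coker_generated].
Qed.

End Graded.

(** * Sequences with eventually polynomial differences *)

Section Antidifference.
Variable K : numFieldType.

(** Expand [(x + 1) ^+ j.+1 - x ^+ j.+1] by the binomial formula: the top term is
    [j.+1%:R * x ^+ j], and the lower powers have antidifferences by induction. *)
Lemma antidifferenceXn j : exists q : {poly K}, forall x, q.[x + 1] - q.[x] = x ^+ j.
Proof.
elim/ltn_ind: j => j IH.
have /choice[q qP] : forall i : 'I_j, exists q : {poly K},
    forall x, q.[x + 1] - q.[x] = x ^+ i by move=> i; exact: IH.
exists (j.+1%:R^-1 *: ('X^(j.+1) - \sum_(i < j) 'C(j.+1, i)%:R *: q i)) => x.
have j0 : j.+1%:R != 0 :> K by rewrite pnatr_eq0.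
rewrite !hornerE !horner_sum -mulrBr; apply: (mulfI j0); rewrite mulVKf //.
have eS : \sum_(i < j) ('C(j.+1, i)%:R *: q i).[x + 1] -
    \sum_(i < j) ('C(j.+1, i)%:R *: q i).[x] = \sum_(i < j) 'C(j.+1, i)%:R * x ^+ i.
  by rewrite -sumrB; apply: eq_bigr => i _; rewrite !hornerE -mulrBr qP.
have eX : (x + 1) ^+ j.+1 =
    \sum_(i < j) 'C(j.+1, i)%:R * x ^+ i + j.+1%:R * x ^+ j + x ^+ j.+1.
  rewrite addrC exprDn !big_ord_recr /= binn binSn !expr1n !mul1r mulr1n mulr_natl.
  by congr (_ + _ + _); apply: eq_bigr => i _; rewrite expr1n mul1r mulr_natl.
rewrite eX -eS; ring.
Qed.

Lemma antidifference (p : {poly K}) : exists q : {poly K}, forall x, q.[x + 1] - q.[x] = p.[x].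
Proof.
have /choice[q qP] := antidifferenceXn.
exists (\sum_(i < size p) p`_i *: q i) => x.
rewrite !horner_sum -sumrB horner_coef; apply: eq_bigr => i _.
by rewrite !hornerE -mulrBr qP.
Qed.

Lemma eventually_poly_sum (u : nat -> K) (p : {poly K}) N :
  (forall n, (N <= n)%N -> u n.+1 - u n = p.[n%:R]) ->
  exists q : {poly K}, forall n, (N <= n)%N -> u n = q.[n%:R].
Proof.
move=> uP; have [q qP] := antidifference p.
(* The constant makes both sides agree at [N]. *)
exists (q + (u N - q.[N%:R])%:P) => n Nn; rewrite -(subnKC Nn).
elim: (n - N)%N => [|m IH]; first by rewrite addn0 hornerD hornerC addrC subrK.
rewrite addnS -[LHS](subrK (u (N + m)%N)) uP ?leq_addr // IH -qP !hornerD !hornerC.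
by rewrite natr1 addrA subrK.
Qed.

End Antidifference.

(** * The Hilbert-Serre theorem for pairs of graded families *)

Section HilbertSerre.
Variables (Rg : comNzRingType) (K : realType) (lam : forall M : lmodType Rg, \bar K).
Hypotheses (noeR : noetherian Rg) (lamP : length_function lam).
Variables (M : lmodType Rg) (y : nat -> {linear M -> M}).
Hypothesis yC : forall i j x, y i (y j x) = y j (y i x).
Hypothesis lf : loc_finite lam [set: M].
Implicit Types P Q : nat -> set M.

(** Multiplication by the last variable, from degree [n] to [n.+1] of [P / Q], expresses the
    difference of the two lengths as that of the cokernel in degree [n.+1] minus that of the kernel
    in degree [n]. Both are polynomial by induction, and differences are summed by
    [eventually_poly_sum]. *)
Theorem hilbert_serre k P Q : (forall n, fgen (P n)) -> stable y k P ->
  subfamily y k P Q Q -> generated y k P Q ->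
  exists (p : {poly K}) N, forall n, (N <= n)%N ->
    len lam (P n) - len lam (Q n) = p.[n%:R].
Proof.
elim: k P Q => [|k IH] P Q fP stP QP gP.
  case: gP QP => c cP [_ _ QP _]; exists 0, c.+1 => -[|n] // cn.
  rewrite horner0; apply/eqP; rewrite subr_eq0; apply/eqP; congr len.
  by apply/seteqP; split; [exact: cP|exact: QP].
have [sQ _ sub_QP stQ] := QP.
have fQ n : fgen (Q n) by apply: fgen_sub (fP n) _ _.
have [p [N pP]] : exists (p : {poly K}) N, forall n, (N <= n)%N ->
    len lam (P n) - len lam (coker y k P Q n) = p.[n%:R].
  by apply: IH => //; [exact: stableW|exact: coker_subfamily].
have LP := colonf_subfamily yC fP stP QP QP.
have [sL QL sub_LP stL] := LP.
have [p' [N' p'P]] : exists (p : {poly K}) N, forall n, (N <= n)%N ->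
    len lam (colonf y k P Q n) - len lam (Q n) = p.[n%:R].
  apply: IH; [|exact: stableW stL|by split=> [|n||] //; exact: stableW stQ|].
    by move=> n; apply: fgen_sub (fP n) _ _.
  have [c cP] := graded_noetherian noeR yC fP stP QP gP LP.
  exists c => n cn; apply: subset_trans (cP n cn) _ => /=.
  (* The last variable maps the kernel into [Q], so generation over [k.+1] variables is already
     generation over [k]. *)
  by apply: gsumS => //; apply: addim_min => // x [].
(* The shift accounts for the cokernel being taken in degree [n.+1]. *)
have pS : exists q : {poly K}, forall n, q.[n%:R] = p.[n.+1%:R].
  by exists (p \Po ('X + 1)) => n; rewrite horner_comp !hornerE natr1.
have [q qP] := pS.
have [|r rP] := @eventually_poly_sum K (fun n => len lam (P n) - len lam (Q n))
    (q - p') (maxn N N').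
  move=> n; rewrite geq_max => /andP[Nn N'n].
  rewrite !hornerE qP -pP ?(leqW Nn) // -p'P //=.
  have := len_addim lamP (y k) noeR lf (fP n) (fQ n.+1).
  rewrite -/(colonf y k P Q n) => e.
  have -> : len lam (addim (y k) (P n) (Q n.+1)) =
    len lam (P n) + len lam (Q n.+1) - len lam (colonf y k P Q n).
    by rewrite e addrC addKr.
  ring.
by exists r, (maxn N N').
Qed.

End HilbertSerre.

(** * The leading term of a Hilbert polynomial *)

Section Hval.
Variable K : realType.
Implicit Types p q : {poly K}.

(** For large arguments, a polynomial with negative leading coefficient is bounded above by that
    coefficient, and some natural number is large enough. *)
Lemma lead_coef_ge0 p N : (forall n, (N <= n)%N -> 0 <= p.[n%:R]) -> 0 <= lead_coef p.
Proof.
move=> pP; case: ltP => // lp.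
have [|b bP] := @polyrcf.poly_pinfty_gt_lc K (- p); first by rewrite lead_coefN oppr_gt0.
have [m bm] : exists m : nat, b <= m%:R.
  by exists (Num.truncn b).+1; apply: ltW; exact: truncnS_gt.
have := bP (maxn N m)%:R; rewrite hornerN lead_coefN lerN2 => h.
have /h : b <= (maxn N m)%:R by apply: le_trans bm _; rewrite ler_nat leq_maxr.
by have := pP _ (leq_maxl N m); lra.
Qed.

Local Open Scope ereal_scope.

Lemma hval_ge0 d p : (0 <= lead_coef p)%R -> 0 <= hval d p.
Proof.
move=> lp; rewrite /hval; case: ifP => // _; case: ifP => // _; case: ifP => // _.
by rewrite lee_fin divr_ge0.
Qed.

(** Nonnegative leading coefficients cannot cancel: at equal degrees they add up, otherwise the
    larger degree decides. *)
Lemma hvalD d p q : (0 <= lead_coef p)%R -> (0 <= lead_coef q)%R ->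
  hval d (p + q)%R = hval d p + hval d q.
Proof.
wlog le : p q / (size q <= size p)%N.
  move=> wl lp lq; case: (leqP (size q) (size p)) => [|/ltnW] le; first exact: wl.
  by rewrite addrC addeC; exact: wl.
move=> lp lq; have [->|q0] := eqVneq q 0%R.
  by rewrite addr0 {3}/hval eqxx adde0.
have p0 : p != 0%R by rewrite -size_poly_gt0 (leq_trans _ le) // size_poly_gt0.
have lp0 : (0 < lead_coef p)%R by rewrite lt_def lp lead_coef_eq0 p0.
have lq0 : (0 < lead_coef q)%R by rewrite lt_def lq lead_coef_eq0 q0.
have sp : (0 < size p)%N by rewrite size_poly_gt0.
have sq : (0 < size q)%N by rewrite size_poly_gt0.
move: le; rewrite leq_eqVlt => /orP[/eqP e|lt].
  have cpq : ((p + q)`_(size p).-1 = lead_coef p + lead_coef q)%R.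
    by rewrite coefD !lead_coefE e.
  have spq : size (p + q)%R = size p.
    apply/eqP; rewrite eqn_leq; apply/andP; split.
      by rewrite (leq_trans (size_polyD _ _)) // e maxnn.
    rewrite leqNgt; apply/negP => h.
    have : ((p + q)`_(size p).-1 = 0)%R by rewrite nth_default // -ltnS prednK.
    by rewrite cpq => h0; have := addr_gt0 lp0 lq0; rewrite h0 ltxx.
  have pq0 : (p + q != 0)%R by rewrite -size_poly_gt0 spq.
  rewrite /hval (negPf pq0) (negPf p0) (negPf q0) e spq.
  rewrite [lead_coef (p + q)%R]lead_coefE spq cpq.
  case: ifP => // _; case: ifP => // _; first by rewrite adde0.
  by rewrite -EFinD mulrDl.
have spq := size_polyDl lt; have lpq := lead_coefDl lt.
have pq0 : (p + q != 0)%R by rewrite -size_poly_gt0 spq.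
(* Nonnegativity serves when [hval d p] is [+oo]: the other summand must not be [-oo]. *)
have := hval_ge0 d lq; rewrite /hval (negPf pq0) (negPf p0) (negPf q0) spq lpq.
have lt' : ((size q).-1 < (size p).-1)%N by rewrite -ltnS !prednK.
case: (ltngtP d (size p).-1) => [dp|dp|dp].
- by move=> h; rewrite addye // gt_eqF // (lt_le_trans (ltNyr 0)).
- have dq := ltn_trans lt' dp.
  by rewrite ltnNge (ltnW dq) /= dq adde0.
- by rewrite dp ltnNge (ltnW lt') /= lt' adde0.
Qed.

Lemma hval_shift d p c : hval d (p \Po ('X + c%:P)) = hval d p.
Proof.
have s2 := @size_XaddC K c.
rewrite /hval -!size_poly_eq0 size_comp_poly2 // lead_coef_comp ?s2 //.
by rewrite lead_coefXaddC expr1n mulr1.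
Qed.

(** The translate of [q] by [c] has the same leading term as [q] and is the sum of [p] and an
    eventually nonnegative polynomial, so [hvalD] applies. *)
Lemma hval_le d p q c N : (forall n, (N <= n)%N -> (0 <= p.[n%:R] <= q.[(n + c)%:R])%R) ->
  hval d p <= hval d q.
Proof.
move=> pq; rewrite -(hval_shift d q c%:R).
have qE n : (q \Po ('X + c%:R%:P)).[n%:R] = q.[(n + c)%:R] :> K.
  by rewrite horner_comp !hornerE natrD.
rewrite -(subrK p (q \Po _)) hvalD.
- apply: leeDr; apply/hval_ge0/(@lead_coef_ge0 _ N) => n Nn.
  by rewrite hornerD hornerN qE subr_ge0; case/andP: (pq n Nn).
- apply: (@lead_coef_ge0 _ N) => n Nn.
  by rewrite hornerD hornerN qE subr_ge0; case/andP: (pq n Nn).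
- by apply: (@lead_coef_ge0 _ N) => n Nn; case/andP: (pq n Nn).
Qed.

Lemma hval_eventually_eq d p q N : (forall n, (N <= n)%N -> p.[n%:R] = q.[n%:R]) ->
  (forall n, (N <= n)%N -> (0 <= p.[n%:R])%R) -> hval d p = hval d q.
Proof.
move=> pq p0; apply/eqP; rewrite eq_le; apply/andP; split;
  by apply: (@hval_le _ _ _ 0 N) => n Nn; rewrite addn0 -?pq // p0 //=.
Qed.

End Hval.

(** * Hilbert polynomials of S-modules *)

Section SModules.
Variables (Rg : comNzRingType) (T : comAlgType Rg) (k : nat) (gam : 'I_k -> T).

Definition incr (i : 'I_k) (alpha : 'I_k -> nat) : 'I_k -> nat :=
  fun j => ((i == j) + alpha j)%N.

Lemma mono_incr i alpha : mono gam (incr i alpha) = gam i * mono gam alpha.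
Proof.
rewrite /mono /incr; under eq_bigr do rewrite exprD.
rewrite big_split /=; congr (_ * _).
rewrite (bigD1 i) //= eqxx expr1 big1 ?mulr1 // => j /negPf ji.
by rewrite eq_sym ji expr0.
Qed.

Lemma tdeg_incr i alpha : tdeg (incr i alpha) = (tdeg alpha).+1.
Proof.
rewrite /tdeg /incr big_split /= (bigD1 i) //= eqxx big1 ?addn0 ?add1n // => j /negPf ji.
by rewrite eq_sym ji.
Qed.

Lemma incr_tdeg_gt0 alpha : (0 < tdeg alpha)%N -> exists i beta, alpha = incr i beta.
Proof.
rewrite lt0n sum_nat_eq0 => /forallPn[i]; rewrite implyTb -lt0n => ai.
exists i, (fun j => alpha j - (i == j))%N; apply/funext => j; rewrite /incr subnKC //.
by case: eqP => // <-.
Qed.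

Lemma mono_tdeg0 alpha : tdeg alpha = 0%N -> mono gam alpha = 1.
Proof.
move/eqP; rewrite sum_nat_eq0 => /forallP h; rewrite /mono big1 // => i _.
by have /eqP -> := h i; rewrite expr0.
Qed.

Section Action.
Variables (M : lmodType Rg) (act : T -> M -> M) (hT : Tmodule act).

Lemma actM s t x : act (s * t) x = act s (act t x). Proof. by case: hT. Qed.
Lemma act1 x : act 1 x = x. Proof. by case: hT. Qed.

(** The proof of [Tmodule act] is an argument so that the linear structure declared below can depend
    on it. *)
Definition actl of Tmodule act := fun t : T => act t.

Lemma actl_linear t : linear (actl hT t).
Proof. by move=> a u v; rewrite /actl; case: hT => -[-> ->]. Qed.

HB.instance Definition _ t := GRing.isLinear.Build Rg M M _ (actl hT t) (actl_linear t).

(* The variables [x_0, .., x_{k-1}] followed by the identity, which plays the role of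
   the homogenizing variable: the filtration [Sn V] is a graded module over [k.+1]
   variables. *)
Definition yop (i : nat) : {linear M -> M} := actl hT (oapp gam 1 (insub i)).

Lemma yopC i j x : yop i (yop j x) = yop j (yop i x).
Proof. by rewrite /yop /= /actl -!actM mulrC. Qed.

Lemma yop_ord (i : 'I_k) x : yop i x = act (gam i) x.
Proof. by rewrite /yop /= valK. Qed.

Lemma yop_id x : yop k x = x.
Proof. by rewrite /yop /= insubF ?ltnn //= /actl act1. Qed.

Implicit Types V W : set M.
Notation Sn := (Sn gam act).
Notation Sspan := (Sspan gam act).

Lemma Sn_submod V n : is_submodule (Sn V n).
Proof. exact: span_submod. Qed.

Lemma Sn_stable V : stable yop k.+1 (Sn V).
Proof.
move=> i n x; rewrite ltnS leq_eqVlt => /orP[/eqP ->|ik].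
  rewrite yop_id; apply: spanS => _ [a [z [an [Vz ->]]]].
  by exists a, z; split=> //; exact: leqW.
rewrite -[i]/(nat_of_ord (Ordinal ik)); move: x.
apply: (@span_min _ _ _ (yop (Ordinal ik) @^-1` Sn V n.+1)).
  exact/preimage_submod/Sn_submod.
move=> _ [a [z [an [Vz ->]]]]; rewrite /preimage /mkset yop_ord -actM -mono_incr.
by apply: sub_span; exists (incr (Ordinal ik) a), z; rewrite tdeg_incr.
Qed.

(** A monomial of degree [n.+1] is a variable times one of degree [n]; those of smaller degree are
    reached through the identity, the variable of index [k]. *)
Lemma Sn_generated V n : Sn V n.+1 `<=` gsum yop k.+1 (Sn V n) [set 0].
Proof.
have s0 := @zero_submod _ M; have sS := Sn_submod V n.
apply: span_min; first exact: gsum_submod.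
move=> _ [a [z [an [Vz ->]]]]; move: an; rewrite leq_eqVlt => /orP[/eqP an|an].
  have [i [b e]] : exists i b, a = incr i b by apply: incr_tdeg_gt0; rewrite an.
  rewrite e mono_incr actM -yop_ord; apply: gsum_l => //; first exact: leqW.
  by apply: sub_span; exists b, z; split=> //; rewrite -ltnS -an e tdeg_incr.
rewrite -[X in gsum _ _ _ _ X]yop_id; apply: gsum_l => //.
by apply: sub_span; exists a, z.
Qed.

Lemma Sn0 V : is_submodule V -> Sn V 0 = V.
Proof.
move=> sV; rewrite -[RHS](span_id sV); apply/seteqP; split; apply: spanS.
  by move=> _ [a [z [+ [Vz ->]]]]; rewrite leqn0 => /eqP/mono_tdeg0 ->; rewrite act1.
move=> x Vx; have t0 : tdeg (fun _ : 'I_k => 0%N) = 0%N by rewrite /tdeg big1.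
by exists (fun=> 0%N), x; rewrite t0 (mono_tdeg0 t0) act1.
Qed.

Lemma Sn_fgen V n : fgen V -> fgen (Sn V n).
Proof.
move=> fV; elim: n => [|n IH]; first by rewrite Sn0 //; exact: fgen_submod.
suff -> : Sn V n.+1 = gsum yop k.+1 (Sn V n) [set 0].
  by apply: fgen_gsum => //; exact: fgen0.
apply/seteqP; split; first exact: Sn_generated.
apply: gsum_min; first exact: Sn_submod.
  by move=> _ ->; exact: submod0 (Sn_submod _ _).
by move=> i x ik; exact: Sn_stable.
Qed.

(** Minimality of the filtration: it is generated in degree 0 by [V], so a stable family containing
    [V] in degree [c] contains all of it, shifted by [c]. *)
Lemma Sn_min V (F : nat -> set M) c : is_submodule V -> (forall n, is_submodule (F n)) ->
  stable yop k.+1 F -> V `<=` F c -> forall n, Sn V n `<=` F (c + n)%N.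
Proof.
move=> sV sF stF VF; elim=> [|n IH]; first by rewrite Sn0 // addn0.
apply: subset_trans (@Sn_generated V n) _; rewrite addnS.
apply: gsum_min => //; first by move=> _ ->; exact: submod0.
by move=> i x ik /IH; exact: stF.
Qed.

Lemma Sn_le V m n : (m <= n)%N -> Sn V m `<=` Sn V n.
Proof.
move=> mn; apply: spanS => _ [a [z [am [Vz ->]]]].
by exists a, z; split=> //; exact: leq_trans mn.
Qed.

Lemma SnS V W n : V `<=` W -> Sn V n `<=` Sn W n.
Proof. by move=> VW; apply: spanS => _ [a [z [am [/VW Wz ->]]]]; exists a, z. Qed.

Lemma Sn_Sspan V n : Sn V n `<=` Sspan V.
Proof. by apply: spanS => _ [a [z [am [Vz ->]]]]; exists a, z. Qed.

Lemma Sspan_Sn V x : Sspan V x -> exists n, Sn V n x.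
Proof.
move: x; apply: span_min.
  split=> [|x z [m Sx] [n Sz]|r x [m Sx]].
  - by exists 0%N; exact: submod0 (Sn_submod _ _).
  - exists (maxn m n); apply: submodD; first exact: Sn_submod.
      by move: Sx; apply: Sn_le; exact: leq_maxl.
    by move: Sz; apply: Sn_le; exact: leq_maxr.
  - by exists m; apply: submodZ => //; exact: Sn_submod.
by move=> _ [a [z [Vz ->]]]; exists (tdeg a); apply: sub_span; exists a, z.
Qed.

Lemma sub_Sspan V : is_submodule V -> V `<=` Sspan V.
Proof. by move=> sV; rewrite -{1}(Sn0 sV); exact: Sn_Sspan. Qed.

Lemma Sspan_S_submodule V : S_submodule gam act (Sspan V).
Proof.
split=> [|i x /Sspan_Sn[n Sx]]; first exact: span_submod.
by rewrite -yop_ord; apply: (@Sn_Sspan V n.+1); apply: Sn_stable => //; exact: leqW.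
Qed.

Lemma Sspan_span (G : set M) : Sspan (span G) = Sspan G.
Proof.
apply/seteqP; split; last first.
  by apply: spanS => _ [a [z [Gz ->]]]; exists a, z; split=> //; exact: sub_span.
apply: span_min; first exact: span_submod.
move=> _ [a [z [Gz ->]]]; move: z Gz.
apply: (@span_min _ _ _ (actl hT (mono gam a) @^-1` Sspan G)).
  exact/preimage_submod/span_submod.
by move=> z Gz; apply: sub_span; exists a, z.
Qed.

Lemma fgen_sub_Sn V W : fgen V -> V `<=` Sspan W -> exists c, V `<=` Sn W c.
Proof.
move=> [s ->] VW.
suff [c cP] : exists c, forall x, x \in s -> Sn W c x.
  by exists c; apply: span_min => //; exact: Sn_submod.
have : forall x, x \in s -> Sspan W x by move=> x xs; apply: VW; exact: sub_span.
elim: s {VW} => [|x s IH] sW; first by exists 0%N.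
have [c cP] : exists c, forall x, x \in s -> Sn W c x.
  by apply: IH => z zs; apply: sW; rewrite inE zs orbT.
have [n Sx] : exists n, Sn W n x by apply: Sspan_Sn; apply: sW; rewrite inE eqxx.
exists (maxn c n) => z; rewrite inE => /orP[/eqP ->|/cP].
  by move: Sx; apply: Sn_le; exact: leq_maxr.
by apply: Sn_le; exact: leq_maxl.
Qed.

(** * Hilbert polynomials of the filtrations and the value of [h_T] *)

Variables (K : realType) (lam : forall M : lmodType Rg, \bar K).
Hypotheses (noeR : noetherian Rg) (lamP : length_function lam).
Hypothesis lf : loc_finite lam [set: M].

Lemma zero_subfamily (P : nat -> set M) : (forall n, is_submodule (P n)) ->
  subfamily yop k.+1 P (fun=> [set 0]) (fun=> [set 0]).
Proof.
move=> sP; split=> [n|n|n _ ->|i n x _ ->] //=.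
- exact: zero_submod.
- exact: submod0.
- by rewrite linear0.
Qed.

Lemma Sn_subfamily_generated V (L : nat -> set M) : fgen V ->
  subfamily yop k.+1 (Sn V) (fun=> [set 0]) L -> generated yop k.+1 L (fun=> [set 0]).
Proof.
move=> fV; apply: (graded_noetherian noeR yopC).
- by move=> n; exact: Sn_fgen.
- exact: Sn_stable.
- exact/zero_subfamily/Sn_submod.
- by exists 0%N => n _; exact: Sn_generated.
Qed.

(** Past the degree [c] where [L] stops needing new generators, [L] is produced from [L c] by the
    variables, which is how [Sn (L c)] is built. *)
Lemma Sn_artin_rees V (L : nat -> set M) : fgen V ->
  subfamily yop k.+1 (Sn V) (fun=> [set 0]) L ->
  exists c, forall n, L (c + n)%N = Sn (L c) n.
Proof.
move=> fV LV; have [c cP] := Sn_subfamily_generated fV LV.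
have [sL _ _ stL] := LV.
exists c => n; apply/seteqP; split; last exact: Sn_min.
elim: n => [|n IH]; first by rewrite addn0 Sn0.
rewrite addnS; apply: subset_trans (cP _ _) _; first exact: leq_addr.
apply: gsum_min; first exact: Sn_submod.
  by move=> _ ->; exact: submod0 (Sn_submod _ _).
by move=> i x ik /IH; exact: Sn_stable.
Qed.

Lemma Sn_subfamily_poly V (L : nat -> set M) : fgen V ->
  subfamily yop k.+1 (Sn V) (fun=> [set 0]) L ->
  exists (p : {poly K}) N, forall n, (N <= n)%N -> lamS lam (L n) = (p.[n%:R])%:E.
Proof.
move=> fV LV; have gL := Sn_subfamily_generated fV LV; have [sL _ sub_LV stL] := LV.
have fL n : fgen (L n) by apply: fgen_sub (Sn_fgen n fV) _ _.
have [|p [N pP]] := hilbert_serre noeR lamP yopC lf fL stL _ gL.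
  exact: zero_subfamily.
have len0 : len lam [set 0 : M] = 0 by rewrite /len lamS0.
by exists p, N => n /pP <-; rewrite -lenK // len0 subr0.
Qed.

Lemma Sn_subfamily_refl V : subfamily yop k.+1 (Sn V) (fun=> [set 0]) (Sn V).
Proof.
split=> [n|n _ ->|n|] //; first exact: Sn_submod.
  exact: submod0 (Sn_submod _ _).
exact: Sn_stable.
Qed.

Lemma Sn_poly V : fgen V ->
  exists (p : {poly K}) N, forall n, (N <= n)%N -> lamS lam (Sn V n) = (p.[n%:R])%:E.
Proof. by move=> fV; apply: Sn_subfamily_poly fV (Sn_subfamily_refl V). Qed.

(** The finitely many generators of [V] lie in a single [Sn W c], so [Sn V n] is inside
    [Sn W (n + c)], and a shift does not affect [hval]. *)
Lemma Sspan_hval_le d V W (p q : {poly K}) N : fgen V -> V `<=` Sspan W ->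
  (forall n, (N <= n)%N -> lamS lam (Sn V n) = (p.[n%:R])%:E) ->
  (forall n, (N <= n)%N -> lamS lam (Sn W n) = (q.[n%:R])%:E) ->
  (hval d p <= hval d q)%E.
Proof.
move=> fV VW pP qP; have [c cP] := fgen_sub_Sn fV VW.
apply: (@hval_le _ _ _ _ c N) => n Nn.
rewrite -!lee_fin -pP // -qP ?(leq_trans Nn (leq_addr _ _)) //.
rewrite lamS_ge0 //=; apply: lamS_le => //; rewrite addnC.
by apply: Sn_min => //; [exact: fgen_submod|exact: Sn_submod|exact: Sn_stable].
Qed.

(** Two generating modules of the same [S]-module are each inside the span of the other, so
    [Sspan_hval_le] in both directions shows that the supremum defining [h_small] is over a single
    value. *)
Lemma h_smallE d V (p : {poly K}) N : fgen V ->
  (forall n, (N <= n)%N -> lamS lam (Sn V n) = (p.[n%:R])%:E) ->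
  h_small gam act lam d (Sspan V) = hval d p.
Proof.
move=> fV pP; rewrite /h_small -[RHS]ereal_sup1; congr ereal_sup.
apply/seteqP; split=> [_ [n [g0 [q [N' [_ SE qP ->]]]]]|_ ->] /=.
  have fW := fgen_range g0; have sV := fgen_submod fV; have sW := fgen_submod fW.
  have pP' m : (maxn N N' <= m)%N -> lamS lam (Sn V m) = (p.[m%:R])%:E.
    by rewrite geq_max => /andP[? _]; exact: pP.
  have qP' m : (maxn N N' <= m)%N -> lamS lam (Sn (span (range g0)) m) = (q.[m%:R])%:E.
    by rewrite geq_max => /andP[_ ?]; exact: qP.
  apply/eqP; rewrite eq_le; apply/andP; split.
    by apply: Sspan_hval_le qP' pP' => //; rewrite -SE; exact: sub_Sspan.
  by apply: Sspan_hval_le pP' qP' => //; rewrite SE; exact: sub_Sspan.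
have [n [v vE]] := fgen_rangeP fV.
by exists n, v, p, N; rewrite -vE; split=> //; exact: lamS_fgen.
Qed.

Lemma Sspan_small V : fgen V -> S_small gam act lam (Sspan V).
Proof.
move=> fV; split; first exact: Sspan_S_submodule.
  by have [n [v ->]] := fgen_rangeP fV; exists n, v; exact: Sspan_span.
by move=> v _; exact: lf.
Qed.

Lemma small_Sspan P : S_small gam act lam P -> exists2 V, fgen V & P = Sspan V.
Proof.
move=> [_ [n [v ->]] _]; exists (span (range v)); first exact: fgen_range.
by rewrite Sspan_span.
Qed.

(** With [h_T_le], this turns [h_T] into the supremum of [hval d p] over finitely generated
    [R]-submodules [V], the form used from here on. *)
Lemma h_T_ge d V (p : {poly K}) N : fgen V ->
  (forall n, (N <= n)%N -> lamS lam (Sn V n) = (p.[n%:R])%:E) ->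
  (hval d p <= h_T gam act lam d)%E.
Proof.
move=> fV pP; apply: ereal_sup_ubound; exists (Sspan V); split; first exact: Sspan_small.
by rewrite (h_smallE d fV pP).
Qed.

Lemma h_T_le d (b : \bar K) : (forall V (p : {poly K}) N, fgen V ->
    (forall n, (N <= n)%N -> lamS lam (Sn V n) = (p.[n%:R])%:E) -> (hval d p <= b)%E) ->
  (h_T gam act lam d <= b)%E.
Proof.
move=> h; apply: ge_ereal_sup => _ [P [/small_Sspan[V fV ->] ->]].
by have [p [N pP]] := Sn_poly fV; rewrite (h_smallE d fV pP); exact: h pP.
Qed.

End Action.

Lemma image_Sn (M N : lmodType Rg) (actM : T -> M -> M) (actN : T -> N -> N)
  (f : {linear M -> N}) V n : Tlinear actM actN f ->
  f @` Sn gam actM V n = Sn gam actN (f @` V) n.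
Proof.
move=> fT; rewrite /Sn image_span; congr span; apply/seteqP; split.
  by move=> _ [_ [a [z [an [Vz ->]]]] <-]; exists a, (f z); rewrite fT; split=> //; split=> //; exists z.
move=> _ [a [_ [an [[z Vz <-] ->]]]]; exists (actM (mono gam a) z); last exact: fT.
by exists a, z.
Qed.

End SModules.

(** * Exact sequences *)

Section ExactSequence.
Variables (Rg : comNzRingType) (K : realType) (lam : forall M : lmodType Rg, \bar K).
Variables (T : comAlgType Rg) (k : nat) (gam : 'I_k -> T) (A B C : lmodType Rg).
Variables (actA : T -> A -> A) (actB : T -> B -> B) (actC : T -> C -> C).
Variables (f : {linear A -> B}) (g : {linear B -> C}).
Hypotheses (noeR : noetherian Rg) (lamP : length_function lam).
Hypotheses (hA : Tmodule actA) (hB : Tmodule actB) (hC : Tmodule actC).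
Hypotheses (fT : Tlinear actA actB f) (gT : Tlinear actB actC g).
Hypotheses (fI : injective f) (gS : forall c, exists b, g b = c).
Hypothesis fgE : forall b, g b = 0 <-> exists a, f a = b.
Hypothesis lfB : loc_finite lam [set: B].

Lemma image_set_inj (P Q : set A) : f @` P = f @` Q -> P = Q.
Proof. by move=> e; apply/funext => a; rewrite -(image_inj fI) e image_inj. Qed.

Lemma fgen_inj_image (P : set A) : is_submodule P -> fgen (f @` P) -> fgen P.
Proof.
move=> sP [s sE].
have /choice[h hP] : forall x, exists a, (f @` P) x -> P a /\ f a = x.
  move=> x; case: (pselect ((f @` P) x)) => [[a Pa fa]|nP]; last by exists 0.
  by exists a.
have sub x : x \in s -> (f @` P) x by rewrite sE; exact: sub_span.
exists (map h s); apply: image_set_inj.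
rewrite image_span sE; congr span; apply/seteqP; split.
  by move=> x xs; have [_ e] := hP x (sub x xs); exists (h x) => //; exact: map_f.
by move=> _ [_ /mapP[x xs ->] <-]; have [_ ->] := hP x (sub x xs).
Qed.

Lemma loc_finite_sub : loc_finite lam [set: A].
Proof.
move=> a _; rewrite -lamS_span // -(lamS_inj_image lamP (@span_submod _ _ _) fI).
by rewrite image_span image_set1 lamS_span //; exact: lfB.
Qed.

Lemma loc_finite_quo : loc_finite lam [set: C].
Proof.
move=> c _; have [b <-] := gS c.
have := lfB (I : [set: B] b); apply: le_lt_trans.
rewrite -(lamS_span lamP [set b]) -(lamS_span lamP [set g b]) -image_set1 -image_span.
rewrite (lamS_ker_image lamP g (@span_submod _ _ [set b])).
exact: leeDr (lamS_ge0 lamP _).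
Qed.

Lemma lamS_exact (P : set B) : is_submodule P ->
  lamS lam P = (lamS lam (f @^-1` P) + lamS lam (g @` P))%E.
Proof.
move=> sP; rewrite (lamS_ker_image lamP g sP); congr (_ + _)%E.
rewrite -(lamS_inj_image lamP (preimage_submod f sP) fI); congr lamS.
apply/seteqP; split=> [x [Px /fgE[a fa]]|_ [a Pa <-]].
  by exists a => //=; rewrite fa.
by split=> //; apply/fgE; exists a.
Qed.

(** The trace of [A] on the filtration of [V]. It is pushed back into [B], since graded families are
    compared inside one fixed module. *)
Lemma image_preimage_subfamily V :
  subfamily (yop gam hB) k.+1 (Sn gam actB V) (fun=> [set 0])
    (fun n => f @` (f @^-1` Sn gam actB V n)).
Proof.
have sS := Sn_submod gam actB V.
split=> [n|n _ ->|n _ [a Sa <-]|i n _ ik [a Sa <-]] //.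
- exact/image_submod/preimage_submod.
- by exists 0; rewrite /= linear0 //; exact: submod0.
- have yf : yop gam hB i (f a) = f (yop gam hA i a) by rewrite /yop /= /actl fT.
  by exists (yop gam hA i a) => //=; rewrite -yf; exact: Sn_stable.
Qed.

(** Lengths add up in each degree along the trace on [A] and the image in [C], and [hvalD] passes to
    leading terms. The trace is not yet known to be a filtration of the form [Sn W]. *)
Lemma hval_exact d V (p q : {poly K}) N : fgen V ->
  (forall n, (N <= n)%N -> lamS lam (Sn gam actB V n) = (p.[n%:R])%:E) ->
  (forall n, (N <= n)%N -> lamS lam (Sn gam actC (g @` V) n) = (q.[n%:R])%:E) ->
  exists (r : {poly K}) N',
    (forall n, (N' <= n)%N -> lamS lam (f @^-1` Sn gam actB V n) = (r.[n%:R])%:E) /\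
    hval d p = (hval d r + hval d q)%E.
Proof.
move=> fV pP qP.
have [r [N' rP]] := Sn_subfamily_poly noeR lamP lfB fV (image_preimage_subfamily V).
have sS := Sn_submod gam actB V.
have rP' n : (N' <= n)%N -> lamS lam (f @^-1` Sn gam actB V n) = (r.[n%:R])%:E.
  by move=> /rP <-; rewrite lamS_inj_image //; exact: preimage_submod.
exists r, N'; split=> //; rewrite -hvalD.
- apply: (@hval_eventually_eq _ _ _ _ (maxn N N')) => n; rewrite geq_max => /andP[Nn N'n].
    apply: EFin_inj; rewrite -pP // hornerD EFinD -rP' // -qP // -(image_Sn _ _ _ gT).
    exact: lamS_exact.
  by rewrite -lee_fin -pP //; exact: lamS_ge0.
- by apply: (@lead_coef_ge0 _ _ N') => n N'n; rewrite -lee_fin -rP' //; exact: lamS_ge0.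
- by apply: (@lead_coef_ge0 _ _ N) => n Nn; rewrite -lee_fin -qP //; exact: lamS_ge0.
Qed.

Lemma h_T_subadditive d :
  (h_T gam actB lam d <= h_T gam actA lam d + h_T gam actC lam d)%E.
Proof.
apply: (h_T_le hB noeR lamP lfB) => V p N fV pP.
have fgV : fgen (g @` V) by exact: fgen_image.
have [q [N1 qP]] := Sn_poly gam hC noeR lamP loc_finite_quo fgV.
have pP' n : (maxn N N1 <= n)%N -> lamS lam (Sn gam actB V n) = (p.[n%:R])%:E.
  by rewrite geq_max => /andP[? _]; exact: pP.
have qP' n : (maxn N N1 <= n)%N -> lamS lam (Sn gam actC (g @` V) n) = (q.[n%:R])%:E.
  by rewrite geq_max => /andP[_ ?]; exact: qP.
have [r [N2 [rP ->]]] := hval_exact d fV pP' qP'.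
apply: leeD; last exact: (h_T_ge hC lamP loc_finite_quo d fgV qP).
have LV := image_preimage_subfamily V.
have [c cE] := Sn_artin_rees noeR fV LV.
have [sL _ LS _] := LV.
have sS := Sn_submod gam actB V.
(* The trace in the Artin-Rees degree [c]; by [WE], its filtration is the whole trace from degree
   [c] on. *)
pose W := f @^-1` Sn gam actB V c.
have sW : is_submodule W by exact: preimage_submod.
have fW : fgen W.
  by apply: fgen_inj_image => //; apply: fgen_sub noeR (Sn_fgen gam hB c fV) _ _; [exact: sL c|exact: LS c].
have WE n : Sn gam actA W n = f @^-1` Sn gam actB V (c + n).
  apply: image_set_inj.
  by rewrite cE (image_Sn _ _ _ fT).
rewrite -(hval_shift d r c%:R).
apply: (h_T_ge hA lamP loc_finite_sub d fW (N := N2)) => n Nn.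
by rewrite WE rP ?(leq_trans Nn (leq_addl _ _)) // horner_comp !hornerE natrD addrC.
Qed.

Lemma hval_add_le d VA VC (p q : {poly K}) N : fgen VA -> fgen VC ->
  (forall n, (N <= n)%N -> lamS lam (Sn gam actA VA n) = (p.[n%:R])%:E) ->
  (forall n, (N <= n)%N -> lamS lam (Sn gam actC VC n) = (q.[n%:R])%:E) ->
  (hval d p + hval d q <= h_T gam actB lam d)%E.
Proof.
move=> fA [t tE] pP; rewrite tE => qP.
have [h hP] := choice gS.
pose W := span [set x | x \in map h t].
have sW : is_submodule W by exact: span_submod.
have fW : fgen W by exists (map h t).
have sA := fgen_submod fA.
have gW : g @` W = span [set x | x \in t].
  rewrite image_span; congr span; apply/seteqP; split.
    by move=> _ [_ /mapP[x xt ->] <-]; rewrite hP.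
  by move=> x xt; exists (h x); [exact: map_f|exact: hP].
pose V := addim f VA W.
have fV : fgen V by exact: fgen_addim.
have sV := fgen_submod fV.
have gV : g @` V = span [set x | x \in t].
  rewrite -gW; apply/seteqP; split=> [_ [z [a Aa Wz] <-]|_ [z Wz <-]].
    exists (z - f a) => //; rewrite linearB.
    have -> : g (f a) = 0 by apply/fgE; exists a.
    exact: subr0.
  by exists z => //; exact: addim_r.
have [r [N1 rP]] := Sn_poly gam hB noeR lamP lfB fV.
have rP' n : (maxn N N1 <= n)%N -> lamS lam (Sn gam actB V n) = (r.[n%:R])%:E.
  by rewrite geq_max => /andP[_ ?]; exact: rP.
have qP' n : (maxn N N1 <= n)%N -> lamS lam (Sn gam actC (g @` V) n) = (q.[n%:R])%:E.
  by rewrite gV geq_max => /andP[? _]; exact: qP.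
have [s [N2 [sP e]]] := hval_exact d fV rP' qP'.
apply: le_trans (h_T_ge hB lamP lfB d fV rP); rewrite e; apply: leeD => //.
apply: (@hval_le _ _ _ _ 0 (maxn N N2)) => n; rewrite geq_max => /andP[Nn N2n].
rewrite addn0 -!lee_fin -pP // -sP // lamS_ge0 //=; apply: lamS_le => // a Sa.
suff : Sn gam actB (f @` VA) n (f a).
  by apply: SnS => _ [x Ax <-]; exact: addim_l.
by rewrite -(image_Sn _ _ _ fT); exists a.
Qed.

(** Suprema are taken in [hval_add_le] one variable at a time, by moving the other term across the
    inequality; this requires finite terms, which holds unless [b] is [+oo]. *)
Lemma h_T_superadditive d :
  (h_T gam actA lam d + h_T gam actC lam d <= h_T gam actB lam d)%E.
Proof.
set b := h_T gam actB lam d.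
have lfA := loc_finite_sub; have lfC := loc_finite_quo.
have ge0 (M : lmodType Rg) (act : T -> M -> M) V (p : {poly K}) N :
    (forall n, (N <= n)%N -> lamS lam (Sn gam act V n) = (p.[n%:R])%:E) ->
    (0 <= hval d p)%E.
  move=> pP; apply/hval_ge0/(@lead_coef_ge0 _ _ N) => n Nn.
  by rewrite -lee_fin -pP //; exact: lamS_ge0.
have key VA VC (p q : {poly K}) N N' : fgen VA -> fgen VC ->
    (forall n, (N <= n)%N -> lamS lam (Sn gam actA VA n) = (p.[n%:R])%:E) ->
    (forall n, (N' <= n)%N -> lamS lam (Sn gam actC VC n) = (q.[n%:R])%:E) ->
    (hval d p + hval d q <= b)%E.
  move=> fA fC pP qP; apply: (@hval_add_le d VA VC p q (maxn N N')) => // n;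
    rewrite geq_max => /andP[? ?]; [exact: pP|exact: qP].
(* Pairing with the zero submodule bounds each term separately by [b], which provides the finiteness
   used in the subtractions. *)
have [p0 [N0 p0P]] := Sn_poly gam hA noeR lamP lfA (@fgen0 _ A).
have [q0 [M0 q0P]] := Sn_poly gam hC noeR lamP lfC (@fgen0 _ C).
have hA0 : (0 <= h_T gam actA lam d)%E.
  by apply: le_trans (ge0 _ _ _ _ _ p0P) _; exact: (h_T_ge hA lamP lfA d (@fgen0 _ A) p0P).
have hAb : (h_T gam actA lam d <= b)%E.
  apply: (h_T_le hA noeR lamP lfA) => V p N fV pP.
  apply: le_trans (key _ _ _ _ _ _ fV (@fgen0 _ C) pP q0P).
  exact: leeDl (ge0 _ _ _ _ _ q0P).
have [->|bfin] := eqVneq b +oo%E; first exact: leey.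
have blt : (b < +oo)%E by rewrite lt_neqAle bfin leey.
have fin x : (0 <= x)%E -> (x <= b)%E -> x \is a fin_num.
  by move=> x0 xb; rewrite ge0_fin_numE //; exact: le_lt_trans blt.
rewrite addeC -leeBrDr; last exact: fin.
apply: (h_T_le hC noeR lamP lfC) => V q N fV qP.
have q_ge0 := ge0 _ _ _ _ _ qP.
have q_le : (hval d q <= b)%E.
  apply: le_trans (key _ _ _ _ _ _ (@fgen0 _ A) fV p0P qP).
  exact: leeDr (ge0 _ _ _ _ _ p0P).
rewrite leeBrDr; last exact: fin.
rewrite addeC -leeBrDr; last exact: fin.
apply: (h_T_le hA noeR lamP lfA) => W p N' fW pP.
by rewrite leeBrDr; [exact: key fW fV pP qP|exact: fin].
Qed.

End ExactSequence.

Theorem theorem9p2 (Rg : comNzRingType) (K : realType)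
  (lam : forall M : lmodType Rg, \bar K)
  (T : comAlgType Rg) (k : nat) (gam : 'I_k -> T)
  (A B C : lmodType Rg)
  (actA : T -> A -> A) (actB : T -> B -> B) (actC : T -> C -> C)
  (f : {linear A -> B}) (g : {linear B -> C}) :
  noetherian Rg ->
  length_function lam ->
  generates gam ->
  Tmodule actA -> Tmodule actB -> Tmodule actC ->
  Tlinear actA actB f -> Tlinear actB actC g ->
  injective f -> (forall c, exists b, g b = c) ->
  (forall b, g b = 0 <-> exists a, f a = b) ->
  loc_finite lam (@setT B) ->
  forall d : nat, (d <= k)%N ->
    h_T gam actB lam d = (h_T gam actA lam d + h_T gam actC lam d)%E.
Proof.
move=> noeR lamP _ hA hB hC fT gT fI gS fgE lfB d _.
apply/eqP; rewrite eq_le; apply/andP; split.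
- exact: (h_T_subadditive gam noeR lamP hA hB hC fT gT fI gS fgE lfB).
- exact: (h_T_superadditive gam noeR lamP hA hB hC fT gT fI gS fgE lfB).
Qed.
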